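(* Let $E$ be a complex finite dimensional vector space and let $L$ be a complex nilpotent Lie subalgebra of $\mathcal{L}(E)^{op}$, with $n=\dim L$. Then, for every $k$ with $0\le k\le n$, $$Sp(L,E)=\sigma_{\delta,k}(L,E)=\sigma_{\pi,k}(L,E).$$
   Context: $\mathcal{L}(E)$ is the algebra of all linear transformations of $E$, and $\mathcal{L}(E)^{op}$ is the same vector space with the opposite product, regarded as a Lie algebra with its commutator bracket; thus $[x,y]=yx-xy$ in terms of ordinary composition. $L^*$ is the dual vector space of $L$. For $e\in E$ and $x\in L$ write $e\cdot x:=x(e)$. Let $n=\dim L$. A character of $L$ is an $f\in L^*$ with $f([x,y])=0$ for all $x,y\in L$. For a character $f$, $(E\otimes\wedge L,d(f))$ is the chain complex with maps $d_p(f)\colon E\otimes\wedge^pL\to E\otimes\wedge^{p-1}L$, $$d_p(f)\big(e\otimes x_1\wedge\dots\wedge x_p\big)=\sum_{k=1}^p(-1)^{k+1}\big(e\cdot x_k-f(x_k)e\big)\otimes x_1\wedge\dots\wedge\hat{x_k}\wedge\dots\wedge x_p+\sum_{1\le k<l\le p}(-1)^{k+l}e\otimes[x_k,x_l]\wedge x_1\wedge\dots\wedge\hat{x_k}\wedge\dots\wedge\hat{x_l}\wedge\dots\wedge x_p$$ for $1\le p\le n$ (where $\hat{\ }$ means deletion), and $d_p(f)=0$ if $p\le 0$ or $p\ge n+1$. Its homology is $H_p(E\otimes\wedge L,d(f))=\ker d_p(f)/\operatorname{im} d_{p+1}(f)$. The joint spectrum is $Sp(L,E)=\{f\in L^*\colon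 f \text{ is a character of } L \text{ and } H_p(E\otimes\wedge L,d(f))\neq0 \text{ for some } p\}$. For $0\le p\le n$ put $\Sigma_p(L,E)=\{f\in L^*\colon f\text{ is a character of }L\text{ and } H_p(E\otimes\wedge L,d(f))\ne0\}$. For $0\le k\le n$, $$\sigma_{\delta,k}(L,E)=\bigcup_{0\le p\le k}\Sigma_p(L,E),\qquad \sigma_{\pi,k}(L,E)=\bigcup_{k\le p\le n}\Sigma_p(L,E).$$ *)

(* Defs.v *)
From HB Require Import structures.
From mathcomp Require Import all_boot all_order all_algebra.
From mathcomp Require Import generic_quotient ring_quotient.
From mathcomp Require reals classical_sets.
From mathcomp Require Export complex.

Set Implicit Arguments.
Unset Strict Implicit.
Unset Printing Implicit Defensive.

Import GRing.Theory.
Local Open Scope ring_scope.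

Section LieSubalgebra.
Context {F : fieldType} {E : vectType F}.
Implicit Types (x y : 'End(E)) (U V W L : {vspace 'End(E)}).

(* The commutator xy - yx computed for the opposite product of 'End(E); with
   \o the ordinary composition this is yx - xy. *)
Definition lie_op x y : 'End(E) := ((y \o x) - (x \o y))%VF.

Definition lie_subalgebra L :=
  forall x y, x \in L -> y \in L -> lie_op x y \in L.

(* The span of all [x, y] with x in U and y in V; by bilinearity it suffices
   to let x and y range over bases, see commv_subP. *)
Definition commv U V : {vspace 'End(E)} :=
  <<[seq lie_op x y | x <- vbasis U, y <- vbasis V]>>%VS.

Fixpoint lower_central L (m : nat) : {vspace 'End(E)} :=
  if m is m'.+1 then commv L (lower_central L m') else L.

Definition lie_nilpotent L := exists m, lower_central L m = 0%VS.

Lemma lie_opDl x1 x2 y : lie_op (x1 + x2) y = lie_op x1 y + lie_op x2 y.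
Proof.
by apply/lfunP=> e; rewrite !(add_lfunE, opp_lfunE, comp_lfunE) linearD opprD addrACA.
Qed.

Lemma lie_opZl a x y : lie_op (a *: x) y = a *: lie_op x y.
Proof.
apply/lfunP=> e.
by rewrite !(add_lfunE, opp_lfunE, comp_lfunE, scale_lfunE) linearZ scalerBr.
Qed.

Lemma lie_opC x y : lie_op x y = - lie_op y x.
Proof. by rewrite /lie_op opprB. Qed.

Lemma lie_opDr x y1 y2 : lie_op x (y1 + y2) = lie_op x y1 + lie_op x y2.
Proof. by rewrite ![lie_op x _]lie_opC lie_opDl opprD. Qed.

Lemma lie_opZr a x y : lie_op x (a *: y) = a *: lie_op x y.
Proof. by rewrite ![lie_op x _]lie_opC lie_opZl scalerN. Qed.

Lemma lie_opxx x : lie_op x x = 0.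
Proof. exact: subrr. Qed.

Lemma lie_op0l y : lie_op 0 y = 0.
Proof. by rewrite /lie_op comp_lfun0l comp_lfun0r subrr. Qed.

Lemma lie_op0r x : lie_op x 0 = 0.
Proof. by rewrite lie_opC lie_op0l oppr0. Qed.

Lemma commv_subP U V W :
  reflect (forall x y, x \in U -> y \in V -> lie_op x y \in W)
          (commv U V <= W)%VS.
Proof.
apply: (iffP span_subvP) => [sW x y xU yV | sW z /allpairsP[[x y] /= [xU yV ->]]].
  rewrite (coord_vbasis xU) (coord_vbasis yV).
  elim/big_rec: _ => [|i u _ IH].
    by rewrite lie_op0l mem0v.
  rewrite lie_opDl memvD // lie_opZl memvZ // {IH u}.
  elim/big_rec: _ => [|j u _ IH].
    by rewrite lie_op0r mem0v.
  rewrite lie_opDr memvD // lie_opZr memvZ //; apply: sW.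
  apply/allpairsP; exists ((vbasis U)`_i, (vbasis V)`_j).
  by split=> //=; apply: mem_nth; rewrite size_tuple.
by apply: sW; apply: vbasis_mem.
Qed.

End LieSubalgebra.

Section KoszulComplex.
Context {F : fieldType} {E : vectType F} (L : {vspace 'End(E)}).

Local Notation n := (\dim L).
Local Notation g := (subvs_of L).

(* The projection vsproj L is harmless as soon as L is a Lie subalgebra. *)
Definition lie_br (x y : g) : g := vsproj L (lie_op (vsval x) (vsval y)).

Definition dual_space : vectType F := 'Hom(g, F^o).

Definition is_character (f : dual_space) := forall x y : g, f (lie_br x y) = 0.

Definition lbasis (i : 'I_n) : g := vsproj L (vbasis L)`_i.

Definition lcoord (i : 'I_n) (x : g) : F := coord (vbasis L) i (vsval x).

(* E (x) /\L. With b_0, ..., b_(n-1) the basis lbasis of L, the value at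
   A = {i_1 < ... < i_p} of c : chain is the coefficient (a vector of E) of
   b_(i_1) /\ ... /\ b_(i_p) in c. *)
Definition chain : vectType F := {ffun {set 'I_n} -> E}.

(* E (x) /\^p L: chains whose coefficients vanish outside the p-subsets. *)
Definition off_degree (p : nat) (c : chain) : chain :=
  [ffun A : {set 'I_n} => if #|A| == p then 0 else c A].

Fact off_degree_is_linear p : linear (off_degree p).
Proof.
by move=> a u v; apply/ffunP=> A; rewrite !ffunE; case: ifP; rewrite ?scaler0 ?addr0.
Qed.
HB.instance Definition _ p :=
  GRing.isLinear.Build F chain chain _ (off_degree p) (off_degree_is_linear p).

Definition chain_deg (p : nat) : {vspace chain} := lker (linfun (off_degree p)).

Definition below (i : 'I_n) (A : {set 'I_n}) : nat :=
  #|[set j in A | (j < i)%N]|.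

(* Left exterior multiplication by a basis vector; the sign moves b_i past the
   basis vectors of smaller index. *)
Definition wedge_basis (i : 'I_n) (c : chain) : chain :=
  [ffun A : {set 'I_n} =>
    if i \in A then (-1) ^+ below i A *: c (A :\ i) else 0].

Definition wedge (x : g) (c : chain) : chain :=
  \sum_(i < n) lcoord i x *: wedge_basis i c.

Definition chain0 (e : E) : chain :=
  [ffun A : {set 'I_n} => if A == set0 then e else 0].

(* e (x) x_1 /\ ... /\ x_p for s = [:: x_1; ...; x_p] *)
Definition tens (e : E) (s : seq g) : chain := foldr wedge (chain0 e) s.

Definition del (k : nat) (s : seq g) : seq g := take k s ++ drop k.+1 s.

(* e.x - f(x) e *)
Definition twact (f : dual_space) (x : g) (e : E) : E := vsval x e - f x *: e.

(* The value of d(f) on e (x) x_1 /\ ... /\ x_p. Positions are counted from 0,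
   hence the sign (-1)^k where counting from 1 gives (-1)^(k+1). *)
Definition koszul_formula (f : dual_space) (e : E) (s : seq g) : chain :=
  \sum_(k < size s) (-1) ^+ k *: tens (twact f s`_k e) (del k s)
  + \sum_(l < size s) \sum_(k < l)
      (-1) ^+ (k + l) *: tens e (lie_br s`_k s`_l :: del k (del l s)).

(* d(f) is given by koszul_formula on the monomials e (x) b_A (enum A is
   increasing), hence on all e (x) x_1 /\ ... /\ x_p by koszul_tens. *)
Definition koszul_fun (f : dual_space) (c : chain) : chain :=
  \sum_(A : {set 'I_n}) koszul_formula f (c A) (map lbasis (enum A)).

Definition koszul (f : dual_space) : 'End(chain) := linfun (koszul_fun f).

(* ker d_p(f) and im d_(p+1)(f) *)
Definition cycles (f : dual_space) (p : nat) : {vspace chain} :=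
  (chain_deg p :&: lker (koszul f))%VS.

Definition boundaries (f : dual_space) (p : nat) : {vspace chain} :=
  (koszul f @: chain_deg p.+1)%VS.

(* H_p, the quotient of the space of p-cycles by the p-boundaries in it *)
Definition homology (f : dual_space) (p : nat) : zmodType :=
  {ideal_quot pred_of_vspace
     (linfun (@vsval F chain (cycles f p)) @^-1: boundaries f p)%VS}.

(* Consistency of the definitions: tens is multilinear and alternating, the
   monomials e (x) b_A span, d(f) satisfies its defining formula on every
   e (x) x_1 /\ ... /\ x_p, tens e s has degree size s,
   and H_p <> 0 iff some p-cycle is no boundary. *)

Fact wedge_basis_is_linear i : linear (wedge_basis i).
Proof.
move=> a u v; apply/ffunP=> A; rewrite !ffunE; case: ifP => _; last first.
  by rewrite scaler0 addr0.
by rewrite scalerDr !scalerA mulrC.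
Qed.
HB.instance Definition _ i :=
  GRing.isLinear.Build F chain chain _ (wedge_basis i) (wedge_basis_is_linear i).

Fact wedge_is_linear x : linear (wedge x).
Proof.
move=> a u v; rewrite /wedge scaler_sumr -big_split; apply: eq_bigr => i _ /=.
by rewrite linearP scalerDr !scalerA mulrC.
Qed.
HB.instance Definition _ x :=
  GRing.isLinear.Build F chain chain _ (wedge x) (wedge_is_linear x).

Lemma lcoordP a x y i : lcoord i (a *: x + y) = a * lcoord i x + lcoord i y.
Proof. by rewrite /lcoord !linearP. Qed.

Lemma lcoord_basis i j : lcoord i (lbasis j) = (i == j)%:R.
Proof.
rewrite /lcoord /lbasis vsprojK; last first.
  by apply: vbasis_mem; apply: mem_nth; rewrite size_tuple.
by rewrite coord_free ?(basis_free (vbasisP L)) // eq_sym.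
Qed.

Lemma lcoord_sum x : x = \sum_i lcoord i x *: lbasis i.
Proof.
apply: val_inj; rewrite /= {1}(coord_vbasis (valP x)) linear_sum.
apply: eq_bigr => i _; rewrite linearZ /= vsprojK //.
by apply: vbasis_mem; apply: mem_nth; rewrite size_tuple.
Qed.

Lemma wedgeP a x y c : wedge (a *: x + y) c = a *: wedge x c + wedge y c.
Proof.
rewrite /wedge scaler_sumr -big_split; apply: eq_bigr => i _ /=.
by rewrite lcoordP scalerDl scalerA.
Qed.

Lemma wedge0l c : wedge 0 c = 0.
Proof. by have := wedgeP (-1) 0 0 c; rewrite scaleN1r addNr scaleN1r addNr. Qed.

Lemma wedge_suml I (r : seq I) (P : pred I) (a : I -> F) (x : I -> g) c :
  wedge (\sum_(i <- r | P i) a i *: x i) c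
  = \sum_(i <- r | P i) a i *: wedge (x i) c.
Proof.
elim/big_rec2: _ => [|i y v _ <-]; first exact: wedge0l.
exact: wedgeP.
Qed.

Lemma wedge_lbasis i c : wedge (lbasis i) c = wedge_basis i c.
Proof.
rewrite /wedge (bigD1 i) //= lcoord_basis eqxx scale1r big1 ?addr0 // => j ji.
by rewrite lcoord_basis (negPf ji) scale0r.
Qed.

Lemma belowU1 (i j : 'I_n) (A : {set 'I_n}) :
  j \notin A -> below i (j |: A) = ((j < i) + below i A)%N.
Proof.
move=> jA; rewrite /below; case ji: (j < i)%N.
  have -> : [set k in j |: A | (k < i)%N] = j |: [set k in A | (k < i)%N].
    by apply/setP=> k; rewrite !inE; have [->|] := eqVneq k j; rewrite ?ji.
  by rewrite cardsU1 inE (negPf jA).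
congr #|pred_of_set _|; apply/setP=> k; rewrite !inE.
by have [->|] := eqVneq k j; rewrite //= ?ji ?andbF.
Qed.

Lemma belowD1 (i j : 'I_n) (A : {set 'I_n}) :
  j \in A -> below i A = ((j < i) + below i (A :\ j))%N.
Proof. by move=> jA; rewrite -belowU1 ?setD1K // !inE eqxx. Qed.

Lemma sign_lt (i j : 'I_n) : i != j ->
  (-1) ^+ (i < j)%N = - (-1) ^+ (j < i)%N :> F.
Proof.
by rewrite -val_eqE /=; case: ltngtP => //= _ _; rewrite ?expr1 ?expr0 ?opprK.
Qed.

Lemma wedge_basisxx i c : wedge_basis i (wedge_basis i c) = 0.
Proof.
by apply/ffunP=> A; rewrite !ffunE !inE eqxx /= scaler0; case: ifP.
Qed.

Lemma wedge_basisC i j c : i != j ->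
  wedge_basis i (wedge_basis j c) = - wedge_basis j (wedge_basis i c).
Proof.
move=> ij; apply/ffunP=> A; rewrite !ffunE !inE (eq_sym j i) ij /=.
case iA: (i \in A); case jA: (j \in A); rewrite ?scaler0 ?oppr0 //.
rewrite (belowD1 i jA) (belowD1 j iA) !exprD !scalerA.
rewrite (setDDl A [set i]) (setDDl A [set j]) setUC (sign_lt ij) -scaleNr.
by congr (_ *: _); rewrite !mulNr opprK mulrAC.
Qed.

Lemma sum_pairs (V : zmodType) (G : 'I_n -> 'I_n -> V) :
  \sum_i \sum_j G i j =
  \sum_i G i i + \sum_(i < n) \sum_(j < n | (i < j)%N) (G i j + G j i).
Proof.
transitivity (\sum_(i < n) (G i i + (\sum_(j < n | (i < j)%N) G i j
                              + \sum_(j < n | (j < i)%N) G i j))).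
  apply: eq_bigr => i _; rewrite (bigD1 i) //=; congr (_ + _).
  rewrite (bigID (fun j : 'I_n => (i < j)%N)) /=.
  congr (_ + _); apply: eq_bigl => j; rewrite -val_eqE /=;
    by case: ltngtP.
rewrite !big_split /=; congr (_ + _); under [in RHS]eq_bigr do rewrite big_split /=.
rewrite [in RHS]big_split /=; congr (_ + _).
by rewrite (exchange_big_dep xpredT).
Qed.

Lemma wedgexx x c : wedge x (wedge x c) = 0.
Proof.
rewrite {1}/wedge.
transitivity (\sum_i \sum_j (lcoord i x * lcoord j x)
                *: wedge_basis i (wedge_basis j c)).
  apply: eq_bigr => i _; rewrite /wedge linear_sum scaler_sumr.
  by apply: eq_bigr => j _; rewrite linearZ scalerA.
rewrite sum_pairs big1 => [|i _]; last by rewrite wedge_basisxx scaler0.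
rewrite add0r big1 // => i _; rewrite big1 // => j ij.
rewrite wedge_basisC; last by rewrite -val_eqE /= neq_ltn ij.
by rewrite mulrC scalerN addNr.
Qed.

Lemma wedgeC x y c : wedge x (wedge y c) = - wedge y (wedge x c).
Proof.
have wD u v w : wedge (u + v) w = wedge u w + wedge v w.
  by rewrite -[u]scale1r wedgeP !scale1r.
have := wedgexx (x + y) c; rewrite !wD !linearD /= !wedgexx add0r addr0.
by move/eqP; rewrite addr_eq0 => /eqP.
Qed.

Lemma tens_alt e s k : (k.+1 < size s)%N -> s`_k = s`_k.+1 -> tens e s = 0.
Proof.
elim: s k => [|x s IH] [|k] //=; rewrite ltnS => ks eqk; last first.
  by rewrite (IH k) ?linear0.
by case: s ks eqk {IH} => //= y s _ <-; rewrite wedgexx.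
Qed.

Lemma tens_multilinear e a x y s1 s2 :
  tens e (s1 ++ (a *: x + y) :: s2)
  = a *: tens e (s1 ++ x :: s2) + tens e (s1 ++ y :: s2).
Proof. by elim: s1 => [|z s1 IH] /=; rewrite ?wedgeP // IH linearP. Qed.

Fact tens_is_linear s : linear (tens^~ s).
Proof.
move=> a u v; elim: s => [|x s IH] /=; last by rewrite IH linearP.
by apply/ffunP=> A; rewrite !ffunE; case: ifP => // _; rewrite scaler0 addr0.
Qed.

Lemma tens_monomial e (A B : {set 'I_n}) :
  tens e (map lbasis (enum A)) B = if B == A then e else 0.
Proof.
have := enum_uniq (mem A).
have : sorted ltn (map val (enum A)).
  apply: (subseq_sorted ltn_trans) (iota_ltn_sorted 0 n).
  by rewrite -val_enum_ord map_subseq // enumT; apply: filter_subseq.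
have -> : (B == A) = (B == [set i in enum A]).
  by congr (_ == _); apply/setP=> i; rewrite inE mem_enum.
elim: (enum A) B => [|i s IH] B /=; first by rewrite ffunE set_nil.
move=> /[dup] /path_sorted srt ord /andP[is_ us].
rewrite wedge_lbasis ffunE IH //.
have si k : k \in s -> (i < k)%N.
  move=> ks; have /allP/(_ (val k)) := order_path_min ltn_trans ord.
  by apply; apply: map_f.
have [iB|iB] := boolP (i \in B); last first.
  by case: eqP => // eB; rewrite eB !inE eqxx in iB.
have -> : (B :\ i == [set j in s]) = (B == [set j in i :: s]).
  apply/eqP/eqP => [eB | ->]; apply/setP=> k; rewrite !inE.
    move/setP/(_ k): eB; rewrite !inE.
    by case: eqVneq => [->|_] //=; rewrite iB.
  by case: eqVneq => [->|] //=; rewrite (negPf is_).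
case: eqP => [eB|_]; last by rewrite scaler0.
rewrite /below (_ : [set j in B | _] = set0) ?cards0 ?expr0 ?scale1r //.
apply/setP=> k; rewrite eB !inE; case: eqVneq => [->|_] /=.
  by rewrite ltnn.
by case ks: (k \in s) => //=; rewrite ltnNge ltnW ?si.
Qed.

Lemma chain_ext (c1 c2 : chain) : c1 =1 c2 -> c1 = c2.
Proof. by move/(ffunP (c1 : {ffun {set 'I_n} -> E}) c2). Qed.

Lemma chain_degP p (c : chain) :
  reflect (forall A : {set 'I_n}, #|A| != p -> c A = 0) (c \in chain_deg p).
Proof.
rewrite memv_ker lfunE /=; apply: (iffP eqP) => [/ffunP c0 A Ap | c0].
  by have := c0 A; rewrite !ffunE (negPf Ap).
by apply/ffunP=> A; rewrite !ffunE; case: ifPn => // /c0.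
Qed.

Lemma wedge_deg p x c : c \in chain_deg p -> wedge x c \in chain_deg p.+1.
Proof.
move=> /chain_degP c0; rewrite memv_suml // => i _; rewrite memvZ //.
apply/chain_degP => A Ap; rewrite ffunE; case: ifP => // iA.
rewrite c0 ?scaler0 //; apply: contraNneq Ap => <-.
by rewrite (cardsD1 i A) iA.
Qed.

Lemma tens_deg e s : tens e s \in chain_deg (size s).
Proof.
elim: s => [|x s IH] /=; last exact: wedge_deg.
by apply/chain_degP => A; rewrite ffunE cards_eq0 => /negPf ->.
Qed.

Lemma chain_sum (c : chain) :
  c = \sum_(A : {set 'I_n}) tens (c A) (map lbasis (enum A)).
Proof.
apply: chain_ext => B; rewrite sum_ffunE (bigD1 B) //= tens_monomial eqxx.
by rewrite big1 ?addr0 // => A AB; rewrite tens_monomial eq_sym (negPf AB).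
Qed.

Lemma twact_linear_r f x : linear (twact f x).
Proof.
move=> a u v; rewrite /twact linearP scalerBr scalerDr opprD addrACA.
by congr (_ - _ + _); rewrite !scalerA mulrC.
Qed.

Fact koszul_fun_is_linear f : linear (koszul_fun f).
Proof.
move=> a u v; rewrite /koszul_fun scaler_sumr -big_split; apply: eq_bigr => A _.
rewrite /= !ffunE /koszul_formula scalerDr addrACA !scaler_sumr -!big_split /=.
apply: eq_bigr => l _; congr (_ + _).
  by rewrite twact_linear_r tens_is_linear scalerDr !scalerA mulrC.
rewrite scaler_sumr -big_split; apply: eq_bigr => k _ /=.
by rewrite tens_is_linear linearP scalerDr !scalerA mulrC.
Qed.
HB.instance Definition _ f :=
  GRing.isLinear.Build F chain chain _ (koszul_fun f) (koszul_fun_is_linear f).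

(* Coordinate form of koszul_formula, through contractions. *)
Definition contract (i : 'I_n) (c : chain) : chain :=
  [ffun A : {set 'I_n} =>
    if i \in A then 0 else (-1) ^+ below i A *: c (i |: A)].

Fact contract_is_linear i : linear (contract i).
Proof.
move=> a u v; apply/ffunP=> A; rewrite !ffunE; case: ifP => _.
  by rewrite scaler0 addr0.
by rewrite scalerDr !scalerA mulrC.
Qed.
HB.instance Definition _ i :=
  GRing.isLinear.Build F chain chain _ (contract i) (contract_is_linear i).

Lemma contract_wedge_basis i j c :
  contract i (wedge_basis j c) = (i == j)%:R *: c - wedge_basis j (contract i c).
Proof.
apply: chain_ext => A; rewrite !ffunE !inE.
have [->|ij] := eqVneq i j; rewrite ?scale1r ?scale0r ?add0r /=.
  case jA: (j \in A); last first.
    by rewrite belowU1 ?jA // setU1K ?jA // ltnn scalerA -expr2 sqrr_sign scale1r subr0.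
  by rewrite (belowD1 _ jA) ltnn setD1K // scalerA -expr2 sqrr_sign scale1r subrr.
case iA: (i \in A); case jA: (j \in A); rewrite ?scaler0 ?oppr0 //=.
have -> : (i |: A) :\ j = i |: (A :\ j).
  by apply/setP=> k; rewrite !inE; have [->|] := eqVneq k j; rewrite // eq_sym (negPf ij).
rewrite belowU1 ?iA // (belowD1 _ jA) !exprD !scalerA (sign_lt ij) -scaleNr.
by congr (_ *: _); rewrite mulNr mulrN mulrACA -expr2 sqrr_sign mul1r mulrC.
Qed.

Lemma contract_wedge i x c :
  contract i (wedge x c) = lcoord i x *: c - wedge x (contract i c).
Proof.
rewrite /wedge linear_sum /= -sumrN [X in _ = X + _](_ : _ = \sum_(j < n) (lcoord j x * (i == j)%:R) *: c).
  rewrite -big_split; apply: eq_bigr => j _ /=.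
  by rewrite linearZ /= contract_wedge_basis scalerBr scalerA.
rewrite (bigD1 i) //= eqxx mulr1 big1 ?addr0 // => j ji.
by rewrite eq_sym (negPf ji) mulr0 scale0r.
Qed.


Lemma twact_linear_l f e : linear (fun x => twact f x e).
Proof.
move=> a x y; rewrite /twact linearP /= linearP add_lfunE scale_lfunE.
by rewrite scalerDl scalerBr opprD addrACA scalerA.
Qed.

Definition chain_act f (x : g) (c : chain) : chain :=
  [ffun A : {set 'I_n} => twact f x (c A)].

Fact chain_act_is_linear f x : linear (chain_act f x).
Proof. by move=> a u v; apply/ffunP=> A; rewrite !ffunE twact_linear_r. Qed.
HB.instance Definition _ f x :=
  GRing.isLinear.Build F chain chain _ (chain_act f x) (chain_act_is_linear f x).

Lemma chain_act_sum f x c :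
  chain_act f x c = \sum_j lcoord j x *: chain_act f (lbasis j) c.
Proof.
have actP a y z : chain_act f (a *: y + z) c = a *: chain_act f y c + chain_act f z c.
  by apply/ffunP=> A; rewrite !ffunE twact_linear_l.
rewrite {1}[x]lcoord_sum; elim/big_rec2: _ => [|i y z _ <-]; last exact: actP.
by have := actP (-1) 0 0; rewrite scaleN1r addNr scaleN1r addNr.
Qed.

Lemma chain_act_wedge f x y c :
  chain_act f x (wedge y c) = wedge y (chain_act f x c).
Proof.
rewrite /wedge linear_sum; apply: eq_bigr => i _; rewrite linearZ /=; congr (_ *: _).
have tw0 : twact f x 0 = 0 by rewrite /twact linear0 scaler0 subrr.
have twZ a e : twact f x (a *: e) = a *: twact f x e.
  by rewrite -[a *: e]addr0 twact_linear_r tw0 addr0.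
by apply/ffunP=> A; rewrite !ffunE; case: ifP => // _; rewrite ?twZ.
Qed.

Lemma chain_act_tens f x e s :
  chain_act f x (tens e s) = tens (twact f x e) s.
Proof.
elim: s => [|y s IH] /=; last by rewrite chain_act_wedge IH.
apply/ffunP=> A; rewrite !ffunE; case: ifP => // _.
by rewrite /twact linear0 scaler0 subrr.
Qed.

Lemma lie_brC x y : lie_br x y = - lie_br y x.
Proof. by rewrite /lie_br lie_opC linearN. Qed.

Lemma lie_brxx x : lie_br x x = 0.
Proof. by rewrite /lie_br lie_opxx linear0. Qed.

Lemma lie_br_sumr x I (r : seq I) (P : pred I) (a : I -> F) (y : I -> g) :
  lie_br x (\sum_(i <- r | P i) a i *: y i)
  = \sum_(i <- r | P i) a i *: lie_br x (y i).
Proof.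
elim/big_rec2: _ => [|i u v _ <-]; first by rewrite /lie_br linear0 lie_op0r linear0.
by rewrite /lie_br linearP lie_opDr lie_opZr linearP.
Qed.

Lemma lie_br_suml x I (r : seq I) (P : pred I) (a : I -> F) (y : I -> g) :
  lie_br (\sum_(i <- r | P i) a i *: y i) x
  = \sum_(i <- r | P i) a i *: lie_br (y i) x.
Proof.
rewrite lie_brC lie_br_sumr -sumrN; apply: eq_bigr => i _.
by rewrite -scalerN -lie_brC.
Qed.

Lemma contract_tens i e s :
  contract i (tens e s)
  = \sum_(k < size s) ((-1) ^+ k * lcoord i s`_k) *: tens e (del k s).
Proof.
elim: s => [|x s IH] /=.
  rewrite big_ord0; apply/ffunP=> A; rewrite !ffunE; case: ifP => // iA.
  case: eqP => [/setP/(_ i)|_]; last by rewrite scaler0.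
  by rewrite !inE eqxx.
rewrite contract_wedge big_ord_recl /= expr0 mul1r /del /= drop0; congr (_ + _).
rewrite IH [wedge _ (bigop.body _ _ _)]linear_sum -sumrN; apply: eq_bigr => k _.
by rewrite linearZ /= -scaleNr /bump /= add1n exprS mulN1r mulNr.
Qed.

Let bracket_part c : chain :=
  \sum_(i < n) \sum_(j < n | (i < j)%N)
    wedge (lie_br (lbasis i) (lbasis j)) (contract i (contract j c)).

Let ad_part x c : chain :=
  \sum_(j < n) wedge (lie_br x (lbasis j)) (contract j c).

Let act_part f c : chain := \sum_(j < n) contract j (chain_act f (lbasis j) c).

Lemma act_part_wedge f x c :
  act_part f (wedge x c) = chain_act f x c - wedge x (act_part f c).
Proof.
rewrite chain_act_sum /act_part [wedge x (bigop.body _ _ _)]linear_sum -sumrB; apply: eq_bigr => j _.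
by rewrite chain_act_wedge contract_wedge.
Qed.

Lemma bracket_part_wedge x c :
  bracket_part (wedge x c) = - ad_part x c - wedge x (bracket_part c).
Proof.
pose G (i j : 'I_n) := lcoord i x *: wedge (lie_br (lbasis i) (lbasis j)) (contract j c).
have -> : ad_part x c = \sum_i \sum_j G i j.
  rewrite exchange_big; apply: eq_bigr => j _ /=.
  by rewrite {1}[x]lcoord_sum lie_br_suml wedge_suml.
rewrite sum_pairs big1 ?add0r => [|i _]; last first.
  by rewrite /G lie_brxx wedge0l scaler0.
rewrite /bracket_part [wedge x (bigop.body _ _ _)]linear_sum -!sumrN -big_split.
apply: eq_bigr => i _ /=.
rewrite [wedge x (bigop.body _ _ _)]linear_sum -!sumrN -big_split; apply: eq_bigr => j _ /=.
rewrite contract_wedge linearB linearZ /= contract_wedge opprB !linearD /= linearZ /=.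
rewrite linearN linearZ /= [wedge _ (wedge _ _)]wedgeC /G (lie_brC (lbasis j)).
rewrite -[- lie_br _ _]scaleN1r -[_ *: lie_br _ _]addr0 wedgeP wedge0l addr0.
rewrite !scaleN1r !scalerN opprK [LHS]addrC [RHS]addrAC.
by congr (_ + _); rewrite addrC.
Qed.

Lemma koszul_formula_cons f e x s :
  koszul_formula f e (x :: s) =
  tens (twact f x e) s - wedge x (koszul_formula f e s)
  - \sum_(l < size s) (-1) ^+ l *: tens e (lie_br x s`_l :: del l s).
Proof.
rewrite /koszul_formula big_ord_recl /= expr0 scale1r /del /= drop0.
rewrite [wedge x (_ + _)]linearD opprD /= -!addrA; congr (_ + _).
rewrite ![wedge x (bigop.body _ _ _)]linear_sum -!sumrN /=; congr (_ + _).
  by apply: eq_bigr => k _; rewrite linearZ /= /bump /= add1n exprS mulN1r scaleNr.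
rewrite big_ord_recl big_ord0 add0r -big_split; apply: eq_bigr => l _ /=.
rewrite big_ord_recl /= drop0 /bump /= !add1n add0n addrC; congr (_ + _).
  by rewrite exprS mulN1r scaleNr.
rewrite [wedge x (bigop.body _ _ _)]linear_sum -sumrN; apply: eq_bigr => k _.
rewrite linearZ /= [in LHS]wedgeC !add1n !add0n addSn addnS !exprS !mulN1r opprK.
by rewrite scalerN.
Qed.

Lemma koszul_formulaE f e s :
  koszul_formula f e s = act_part f (tens e s) + bracket_part (tens e s).
Proof.
elim: s => [|x s IH].
  rewrite /koszul_formula /= !big_ord0 addr0.
  have c0 i e' : contract i (chain0 e') = 0.
    by rewrite [LHS](contract_tens i e' [::]) big_ord0.
  rewrite /act_part big1 ?add0r => [|i _]; last first.
    by rewrite [chain_act _ _ _](chain_act_tens _ _ _ [::]) c0.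
  rewrite /bracket_part big1 // => i _; rewrite big1 // => j _.
  by rewrite c0 !linear0.
rewrite koszul_formula_cons IH /= act_part_wedge bracket_part_wedge.
rewrite chain_act_tens linearD opprD /= -!addrA; congr (_ + (_ + _)).
rewrite addrC; congr (- _ + _).
rewrite /ad_part; under [RHS]eq_bigr do rewrite contract_tens linear_sum.
rewrite exchange_big; apply: eq_bigr => l _ /=.
rewrite {1}[s`_l]lcoord_sum lie_br_sumr wedge_suml scaler_sumr.
by apply: eq_bigr => j _; rewrite [RHS]linearZ /= scalerA.
Qed.

Lemma koszulE f c : koszul f c = koszul_fun f c.
Proof. by rewrite lfunE. Qed.

Theorem koszul_tens f e s : koszul f (tens e s) = koszul_formula f e s.
Proof.
rewrite koszulE koszul_formulaE {2 3}[tens e s]chain_sum.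
have sumE (h : {linear chain -> chain}) : forall (u : {set 'I_n} -> chain),
  h (\sum_A u A) = \sum_A h (u A) by move=> u; rewrite linear_sum.
rewrite /act_part; under eq_bigr do rewrite !linear_sum.
rewrite exchange_big /bracket_part.
under [X in _ + X]eq_bigr do under eq_bigr do rewrite !linear_sum.
under [X in _ + X]eq_bigr do rewrite exchange_big.
rewrite [X in _ + X]exchange_big -big_split; apply: eq_bigr => A _ /=.
exact: koszul_formulaE.
Qed.

Lemma ideal_quot_neq0 (V : vectType F) (U : {vspace V}) :
  (exists h : {ideal_quot pred_of_vspace U}, h != 0) <-> exists v, v \notin U.
Proof.
have pi0 v : ((\pi_{ideal_quot pred_of_vspace U} v)%qT == 0) = (v \in U).
  rewrite -[v in RHS]subr0 -[RHS]/(v - 0 \in pred_of_vspace U).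
  by rewrite Quotient.idealrBE raddf0.
split=> [[h] | [v vU]]; last by exists (\pi v)%qT; rewrite pi0.
by rewrite -[h]reprK pi0; exists (repr h).
Qed.

Lemma homology_neq0 f p :
  (exists h : homology f p, h != 0)
  <-> exists2 c, c \in cycles f p & c \notin boundaries f p.
Proof.
apply: (iff_trans (ideal_quot_neq0 _)).
split=> [[z zB] | [c cZ cB]].
  by exists (vsval z); [apply: subvsP | rewrite -memv_preim lfunE in zB].
by exists (vsproj _ c); rewrite -memv_preim lfunE /= vsprojK.
Qed.

End KoszulComplex.

Import classical_sets.
Local Open Scope classical_set_scope.

Section JointSpectrum.
Context {F : fieldType} {E : vectType F}.
Implicit Types (L : {vspace 'End(E)}) (p k : nat).

Definition Sigma_ L p : set (dual_space L) :=
  [set f | is_character f /\ exists h : homology f p, h != 0].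
Arguments Sigma_ L p f : clear implicits.

Definition joint_spectrum L : set (dual_space L) :=
  [set f | is_character f /\ exists p, exists h : homology f p, h != 0].

Definition sigma_delta L k : set (dual_space L) :=
  \bigcup_(p in [set p | (p <= k)%N]) Sigma_ L p.

Definition sigma_pi L k : set (dual_space L) :=
  \bigcup_(p in [set p | (k <= p <= \dim L)%N]) Sigma_ L p.

End JointSpectrum.
Arguments Sigma_ {F E} L p _.
Arguments joint_spectrum {F E} L _.
Arguments sigma_delta {F E} L k _.
Arguments sigma_pi {F E} L k _.

(* Main.v *)
From HB Require Import structures.
Require Import Defs.
From mathcomp Require Import all_boot all_order all_algebra reals complex.
From mathcomp Require Import boolp.

Set Implicit Arguments.
Unset Strict Implicit.
Unset Printing Implicit Defensive.

Import GRing.Theory.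

(** For a character f write T x = x - f x, a representation of the nilpotent Lie
algebra L on E, and d for the Koszul differential it defines. The claim follows
from [homology_extremes]: if some homology space of d is nonzero, then so are
those in degree 0 and in degree n = dim L.

The first ingredient is Cartan's homotopy formula [koszul_wedge]: exterior
multiplication by x is a homotopy from 0 to the Lie derivative [theta f x],
which commutes with d ([koszul_theta]). Write theta x = A - B, where A applies
T x to the coefficients and B is the adjoint action on the exterior factor.
They commute, and B is locally nilpotent because L is nilpotent. So if V is a
submodule of E on which T x is injective, theta x is bijective on the cycles with
coefficients in V, and by the homotopy formula each of these cycles is a
boundary ([acyclic]).

The second ingredient is the Fitting decomposition V = K + I of a submodule V
with respect to T x. Since ad x is nilpotent, K and I are again submodules. The
part in I carries no homology, so a cycle that is not a boundary may be replaced
by its component in K. By induction on the dimension this produces a direct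
summand V of E, nonzero, on which every T x is nilpotent ([nilpotent_summand]).

The third ingredient is Engel's theorem for V, in the form that the T x map V
into a proper subspace ([engel]); applied repeatedly, it also gives a nonzero
vector v killed by all T x ([engel_kernel]). The first form, with a complement of
V added, shows that the images of the T x do not span E, that is, the homology in
degree 0 is nonzero. The second makes the top chain with coefficient v a cycle, and there are
no boundaries in degree n; here the traces of the ad x, which appear in d on top
chains, vanish by nilpotency. *)

(** * Nilpotency of derivations *)

Section Leibniz.
Local Open Scope ring_scope.
Context {F : fieldType}.

Lemma iter_fix0 (X : zmodType) (D : X -> X) k : D 0 = 0 -> iter k D 0 = 0.
Proof. by move=> D0; elim: k => //= k ->. Qed.

Lemma iter_linear (Z : lmodType F) (D : {linear Z -> Z}) k a (u v : Z) :
  iter k D (u + a *: v) = iter k D u + a *: iter k D v.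
Proof. by elim: k => //= k ->; rewrite linearD linearZ. Qed.

(** The binomial formula expresses the power [a + j] of [D] on [m y e] through
    terms in which either [y] is hit [j] times or [e] is hit [a] times; the
    double induction spares the binomial coefficients. It serves both for the
    action of [L] on [E] and for the adjoint action on exterior powers. *)
Lemma leibniz_nilpotent (X Y : zmodType) (Z : lmodType F) (m : X -> Y -> Z)
    (D1 : X -> X) (D2 : Y -> Y) (D : {linear Z -> Z}) (s : F) :
  (forall e, m 0 e = 0) -> (forall y, m y 0 = 0) ->
  (forall y e, D (m y e) = m y (D2 e) + s *: m (D1 y) e) ->
  forall a j y e, iter j D1 y = 0 -> iter a D2 e = 0 ->
  iter (a + j) D (m y e) = 0.
Proof.
move=> m0l m0r mD; have D0 k := iter_fix0 k (linear0 D).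
elim=> [|a IHa] j y e; first by move=> _ h; rewrite [e]h m0r D0.
elim: j y => [|j IHj] y; first by move=> h _; rewrite [y]h m0l D0.
move=> Dy De; rewrite addnS iterSr mD iter_linear.
rewrite {1}addSnnS IHa // -?iterSr // IHj -?iterSr //.
by rewrite scaler0 addr0.
Qed.

End Leibniz.

Section Commutator.
Local Open Scope ring_scope.
Context {F : fieldType} {E : vectType F}.

Lemma lie_opE (a b : 'End(E)) e : lie_op a b e = b (a e) - a (b e).
Proof. by rewrite add_lfunE opp_lfunE !comp_lfunE. Qed.

Lemma lie_op_jacobi (a b d : 'End(E)) :
  lie_op (lie_op a b) d = lie_op a (lie_op b d) - lie_op b (lie_op a d).
Proof.
apply/lfunP => e; rewrite add_lfunE opp_lfunE !lie_opE.
rewrite !(linearB a, linearB b, linearB d) /=.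
rewrite !opprB [RHS]addrACA !subrKA [LHS]addrACA [RHS]addrACA.
by congr (_ + _); rewrite addrC.
Qed.

End Commutator.

(** * Fitting decomposition *)

Section Fitting.
Local Open Scope ring_scope.
Context {F : fieldType} {E : vectType F}.
Implicit Types (u : 'End(E)) (V W : {vspace E}).

Definition lpow u a : 'End(E) := iter a (fun w => (u \o w)%VF) \1%VF.

Lemma lpowE u a e : lpow u a e = iter a u e.
Proof. by elim: a => [|a IH] /=; rewrite ?id_lfunE // comp_lfunE IH. Qed.

Lemma lker_lpowS u a : (lker (lpow u a) <= lker (lpow u a.+1))%VS.
Proof.
by apply/subvP => e; rewrite !memv_ker !lpowE /= => /eqP ->; rewrite linear0.
Qed.

(** Once two consecutive kernels agree they stay equal, and the dimension of [E]
    bounds the number of strict inclusions. *)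
Lemma lker_lpow_stable u :
  exists a, forall j, (lker (lpow u (a + j)) <= lker (lpow u a))%VS.
Proof.
have [a ha] : exists a, (lker (lpow u a.+1) <= lker (lpow u a))%VS.
  suff H k : (exists a, (lker (lpow u a.+1) <= lker (lpow u a))%VS) \/
             (k <= \dim (lker (lpow u k)))%N.
    have [//|] := H (\dim {:E}).+1.
    by rewrite leqNgt ltnS dimvS ?subvf.
  elim: k => [|k [IH|IH]]; [by right | by left |].
  have [h|h] := boolP (lker (lpow u k.+1) <= lker (lpow u k))%VS.
    by left; exists k.
  right; apply: leq_ltn_trans IH _.
  by rewrite (ltn_leqif (dimv_leqif_sup (lker_lpowS u k))).
exists a; elim=> [|j IH]; first by rewrite addn0.
apply: subv_trans IH; apply/subvP => e; rewrite !memv_ker !lpowE.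
rewrite -addSnnS !iterD => /eqP h.
have /(subvP ha) : iter j u e \in lker (lpow u a.+1) by rewrite memv_ker lpowE h.
by rewrite memv_ker lpowE.
Qed.

Definition nilp_on u V := forall v, v \in V -> exists a, iter a u v = 0.

(** The last two clauses say that kernel and image have become stationary. They
    are what makes both summands stable under operators that commute with [u]
    only up to nilpotent corrections. *)
Lemma fitting u V : (forall v, v \in V -> u v \in V) ->
  exists a, let K := (V :&: lker (lpow u a))%VS in
            let I := (lpow u a @: V)%VS in
  [/\ (K + I = V)%VS, (K :&: I = 0)%VS,
      forall j, (V :&: lker (lpow u (a + j)) <= K)%VS &
      forall j, (I <= lpow u (a + j) @: V)%VS].
Proof.
move=> uV; have [a ha] := lker_lpow_stable u; exists a => K I.
have itV j v : v \in V -> iter j u v \in V.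
  by move=> vV; elim: j => //= j; apply: uV.
have IV : (I <= V)%VS.
  by apply/subvP => _ /memv_imgP[v vV ->]; rewrite lpowE itV.
have KI0 : (K :&: I = 0)%VS.
  apply/eqP; rewrite -subv0; apply/subvP => w /memv_capP[/memv_capP[_ wk]].
  case/memv_imgP => v vV wE; move: wk; rewrite wE memv_ker !lpowE -iterD => h.
  have /(subvP (ha a)) : v \in lker (lpow u (a + a)) by rewrite memv_ker lpowE.
  by rewrite memv_ker lpowE memv0.
split=> // [|j|j].
- apply/eqP; rewrite eqEdim subv_add capvSl IV /=.
  by rewrite dimv_disjoint_sum // limg_ker_dim.
- by apply: capvS.
have jI : (lpow u (a + j) @: V <= I)%VS.
  apply/subvP => _ /memv_imgP[v vV ->]; rewrite lpowE iterD -lpowE memv_img //.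
  exact: itV.
rewrite -(geq_leqif (dimv_leqif_sup jI)) -(leq_add2l (\dim K)) limg_ker_dim.
by rewrite -{1}(limg_ker_dim (lpow u (a + j)) V) leq_add2r dimvS // capvS.
Qed.

End Fitting.

(** * Chains with coefficients in a subspace, and the adjoint action *)

Section Koszul.
Local Open Scope ring_scope.
Context {F : fieldType} {E : vectType F} (L : {vspace 'End(E)}).
Local Notation n := (\dim L).
Local Notation g := (subvs_of L).
Implicit Types (x y z : g) (c : chain L) (e v : E) (V W : {vspace E}).

Lemma wedgeDl x y c : wedge (x + y) c = wedge x c + wedge y c.
Proof. by rewrite -[x]scale1r wedgeP !scale1r. Qed.

Lemma wedgeNl x c : wedge (- x) c = - wedge x c.
Proof. by rewrite -scaleN1r -[_ *: x]addr0 wedgeP wedge0l addr0 scaleN1r. Qed.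

Lemma wedgeBl x y c : wedge (x - y) c = wedge x c - wedge y c.
Proof. by rewrite wedgeDl wedgeNl. Qed.

(** Identities between linear maps on chains are proved by this induction, from
    their commutation rules with [wedge]. *)
Lemma chain_ind (P : chain L -> Prop) :
  P 0 -> (forall c c', P c -> P c' -> P (c + c')) ->
  (forall e, P (chain0 L e)) -> (forall x c, P c -> P (wedge x c)) ->
  forall c, P c.
Proof.
move=> P0 PD Pe Pw c; rewrite [c]chain_sum.
apply: big_ind => // A _; elim: (map _ _) => //= x s; exact: Pw.
Qed.

(** The derivation of the exterior algebra that extends [lie_br x], see
    [ad_ext_wedge]; a derivation is determined by its values on a basis through
    contractions. *)
Definition ad_ext x c : chain L :=
  \sum_(j < n) wedge (lie_br x (lbasis j)) (contract j c).

Fact ad_ext_is_linear x : linear (ad_ext x).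
Proof.
move=> a u v; rewrite /ad_ext scaler_sumr -big_split; apply: eq_bigr => j _ /=.
by rewrite !linearP.
Qed.
HB.instance Definition _ x :=
  GRing.isLinear.Build F (chain L) (chain L) _ (ad_ext x) (ad_ext_is_linear x).

Lemma ad_ext_wedge x y c :
  ad_ext x (wedge y c) = wedge (lie_br x y) c + wedge y (ad_ext x c).
Proof.
rewrite {2}[y]lcoord_sum lie_br_sumr wedge_suml /ad_ext.
rewrite [wedge y (bigop.body _ _ _)]linear_sum -big_split.
apply: eq_bigr => j _ /=.
by rewrite contract_wedge linearB linearZ /= [wedge _ (wedge y _)]wedgeC opprK.
Qed.

Lemma contract_chain0 (i : 'I_n) e : contract i (chain0 L e) = 0.
Proof. by rewrite [LHS](contract_tens i e [::]) big_ord0. Qed.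

Lemma ad_ext_chain0 x e : ad_ext x (chain0 L e) = 0.
Proof. by rewrite /ad_ext big1 // => j _; rewrite contract_chain0 linear0. Qed.

Lemma ad_ext_tens x e s :
  ad_ext x (tens e s) =
  \sum_(l < size s) (-1) ^+ l *: tens e (lie_br x s`_l :: del l s).
Proof.
rewrite /ad_ext; under eq_bigr do rewrite contract_tens linear_sum.
rewrite exchange_big; apply: eq_bigr => l _ /=.
rewrite [in RHS](lcoord_sum s`_l) lie_br_sumr wedge_suml scaler_sumr.
by apply: eq_bigr => j _; rewrite [LHS]linearZ /= scalerA.
Qed.

Lemma contract_deg i p c : c \in chain_deg L p.+1 -> contract i c \in chain_deg L p.
Proof.
move=> /chain_degP c0; apply/chain_degP => A Ap; rewrite ffunE.
case: ifPn => // iA; rewrite c0 ?scaler0 // cardsU1 iA add1n eqSS //.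
Qed.

Lemma contract_deg0 i c : c \in chain_deg L 0 -> contract i c = 0.
Proof.
move=> /chain_degP c0; apply: chain_ext => A; rewrite !ffunE.
by case: ifPn => // iA; rewrite c0 ?scaler0 // cardsU1 iA.
Qed.

Lemma ad_ext_deg x p c : c \in chain_deg L p -> ad_ext x c \in chain_deg L p.
Proof.
case: p => [|p] cp; rewrite /ad_ext memv_suml // => j _.
  by rewrite contract_deg0 // linear0 mem0v.
by rewrite wedge_deg // contract_deg.
Qed.

Definition chain_in V c := forall A, c A \in V.

Lemma chain_in0 V : chain_in V 0.
Proof. by move=> A; rewrite ffunE mem0v. Qed.

Lemma chain_inD V c c' : chain_in V c -> chain_in V c' -> chain_in V (c + c').
Proof. by move=> h h' A; rewrite ffunE memvD. Qed.

Lemma chain_inZ V a c : chain_in V c -> chain_in V (a *: c).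
Proof. by move=> h A; rewrite ffunE memvZ. Qed.

Lemma chain_in_sum V I (r : seq I) (P : pred I) (G : I -> chain L) :
  (forall i, P i -> chain_in V (G i)) -> chain_in V (\sum_(i <- r | P i) G i).
Proof.
move=> h; elim/big_rec: _ => [|i c Pi IH]; first exact: chain_in0.
by apply: chain_inD => //; apply: h.
Qed.

Lemma chain_in_wedge V x c : chain_in V c -> chain_in V (wedge x c).
Proof.
move=> h; apply: chain_in_sum => i _; apply: chain_inZ => A.
by rewrite ffunE; case: ifP; rewrite ?mem0v ?memvZ.
Qed.

Lemma chain_in_tens V e s : e \in V -> chain_in V (tens e s).
Proof.
move=> eV; elim: s => [|x s IH] /=; last exact: chain_in_wedge.
by move=> A; rewrite ffunE; case: ifP; rewrite ?mem0v.
Qed.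

Lemma chain_in_ad_ext V x c : chain_in V c -> chain_in V (ad_ext x c).
Proof.
move=> h; apply: chain_in_sum => i _; apply: chain_in_wedge => A.
by rewrite ffunE; case: ifP; rewrite ?mem0v ?memvZ.
Qed.

Definition chain_map (u : 'End(E)) c : chain L :=
  [ffun A : {set 'I_n} => u (c A)].

Fact chain_map_is_linear u : linear (chain_map u).
Proof. by move=> a c c'; apply/ffunP=> A; rewrite !ffunE linearP. Qed.
HB.instance Definition _ u :=
  GRing.isLinear.Build F (chain L) (chain L) _ (chain_map u) (chain_map_is_linear u).

(** The chains satisfying [chain_in V], cut out by linear equations so that
    dimension arguments apply to them. *)
Definition chain_space V : {vspace chain L} :=
  lker (linfun (chain_map (\1%VF - projv V))).

Lemma chain_spaceP V c : reflect (chain_in V c) (c \in chain_space V).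
Proof.
rewrite memv_ker lfunE /=; apply: (iffP eqP) => [/ffunP h A | h].
  have := h A; rewrite !ffunE add_lfunE opp_lfunE id_lfunE => /eqP.
  by rewrite subr_eq0 => /eqP ->; rewrite memv_proj.
apply/ffunP => A; rewrite !ffunE add_lfunE opp_lfunE id_lfunE.
by rewrite projv_id ?h // subrr.
Qed.

(** * The Lie derivative and Cartan's formula *)

Section Twisted.
Variable f : dual_space L.

Definition tw x : 'End(E) := vsval x - f x *: \1%VF.

Lemma twE x e : tw x e = twact f x e.
Proof. by rewrite add_lfunE opp_lfunE scale_lfunE id_lfunE. Qed.

Lemma tw0 e : tw 0 e = 0.
Proof. by rewrite twE /twact !linear0 lfunE /= scale0r subr0. Qed.

Lemma chain_actE x c A : chain_act f x c A = tw x (c A).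
Proof. by rewrite ffunE twE. Qed.

(** The Lie derivative along [x] on [E] tensored with the exterior algebra: the
    twisted action on coefficients, and, because the action on [E] is a right
    one, minus the adjoint action on the exterior factor. *)
Definition theta_fun x c : chain L := chain_act f x c - ad_ext x c.

Fact theta_fun_is_linear x : linear (theta_fun x).
Proof.
move=> a u v.
rewrite /theta_fun (linearP (chain_act f x)) (linearP (ad_ext x)).
by rewrite opprD addrACA scalerBr.
Qed.
HB.instance Definition _ x := GRing.isLinear.Build F (chain L) (chain L) _
  (theta_fun x) (theta_fun_is_linear x).

Definition theta x : 'End(chain L) := linfun (theta_fun x).

Lemma thetaE x c : theta x c = chain_act f x c - ad_ext x c.
Proof. by rewrite lfunE. Qed.

Lemma koszul_chain0 e : koszul f (chain0 L e) = 0.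
Proof.
by rewrite [LHS](koszul_tens f e [::]) /koszul_formula /= !big_ord0 addr0.
Qed.

(** Cartan's homotopy formula. On monomials it is the recursive form of the
    defining formula of the differential: the bracket terms that involve [x]
    add up to [ad_ext x]. *)
Lemma koszul_wedge x c :
  koszul f (wedge x c) = theta x c - wedge x (koszul f c).
Proof.
rewrite [c]chain_sum; set s := (\sum_(A : _) _).
elim/big_rec: s => [|A s _ IH].
  by rewrite !linear0 addr0.
rewrite !(linearD (wedge x)) !(linearD (koszul f)) (linearD (theta x)) /= IH.
rewrite (linearD (wedge x)) opprD addrACA; congr (_ + _).
rewrite [LHS](koszul_tens f (c A) (x :: _)) koszul_formula_cons -ad_ext_tens.
by rewrite koszul_tens thetaE chain_act_tens addrAC.
Qed.

Lemma theta_wedge x y c :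
  theta x (wedge y c) = wedge y (theta x c) - wedge (lie_br x y) c.
Proof.
rewrite !thetaE chain_act_wedge ad_ext_wedge linearB /= opprD addrA.
by rewrite addrAC.
Qed.

Lemma chain_act_chain0 x e : chain_act f x (chain0 L e) = chain0 L (twact f x e).
Proof. exact: (chain_act_tens f x e [::]). Qed.

Lemma theta_chain0 x e : theta x (chain0 L e) = chain0 L (twact f x e).
Proof. by rewrite thetaE ad_ext_chain0 subr0 chain_act_chain0. Qed.

Lemma chain_act_contract x i c :
  chain_act f x (contract i c) = contract i (chain_act f x c).
Proof.
apply: chain_ext => A; rewrite !chain_actE !ffunE.
by case: ifP; rewrite ?linear0 // linearZ /= -twE.
Qed.

Lemma chain_act_ad_ext x y c :
  chain_act f x (ad_ext y c) = ad_ext y (chain_act f x c).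
Proof.
rewrite /ad_ext linear_sum; apply: eq_bigr => j _ /=.
by rewrite chain_act_wedge chain_act_contract.
Qed.

Definition tw_stable V := forall x v, v \in V -> tw x v \in V.

Lemma chain_in_act V x c : tw_stable V -> chain_in V c -> chain_in V (chain_act f x c).
Proof. by move=> sV h A; rewrite chain_actE sV. Qed.

Lemma chain_in_koszul V c : tw_stable V -> chain_in V c -> chain_in V (koszul f c).
Proof.
move=> sV h; rewrite koszulE; apply: chain_in_sum => A _.
have cA := h A; apply: chain_inD; apply: chain_in_sum => k _.
  by apply: chain_inZ; apply: chain_in_tens; rewrite -twE sV.
by apply: chain_in_sum => l _; apply: chain_inZ; apply: chain_in_tens.
Qed.

Lemma theta_deg x p c : c \in chain_deg L p -> theta x c \in chain_deg L p.
Proof.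
move=> cp; rewrite thetaE rpredB ?ad_ext_deg //; apply/chain_degP => A Ap.
by rewrite chain_actE (chain_degP _ _ cp) ?linear0.
Qed.

Lemma koszul_tens_deg e s : koszul f (tens e s) \in chain_deg L (size s).-1.
Proof.
elim: s => [|x s IH]; first by rewrite koszul_chain0 mem0v.
rewrite /= koszul_wedge rpredB ?theta_deg ?tens_deg //.
case: s IH => [|y s] IH; first by rewrite koszul_chain0 linear0 mem0v.
exact: wedge_deg.
Qed.

Hypothesis L_sub : lie_subalgebra L.

Lemma vsval_lie_br x y : vsval (lie_br x y) = lie_op (vsval x) (vsval y).
Proof. by rewrite /lie_br vsprojK // L_sub // subvsP. Qed.

Lemma lie_br_jacobi x y z :
  lie_br (lie_br x y) z = lie_br x (lie_br y z) - lie_br y (lie_br x z).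
Proof.
apply: val_inj; rewrite [RHS](linearB (@vsval _ _ L)) /= !vsval_lie_br.
exact: lie_op_jacobi.
Qed.

Hypothesis f_char : is_character f.

(** The twist by [f] does not disturb brackets precisely because [f] vanishes on
    them. The order of the factors is reversed since [lie_br] is the commutator
    of the opposite product. *)
Lemma tw_lie_br x y e : tw (lie_br x y) e = tw y (tw x e) - tw x (tw y e).
Proof.
rewrite !twE /twact f_char scale0r subr0 vsval_lie_br lie_opE.
move: (vsval x : 'End(E)) (vsval y : 'End(E)) (f x) (f y) => a b s t.
have lin (u : 'End(E)) r p q : u (p - r *: q) = u p - r *: u q.
  by rewrite linearB linearZ.
rewrite !{}lin.
have sB r p q : r *: (p - q) = r *: p - r *: q :> E by rewrite scalerBr.
rewrite !{}sB !opprB.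
rewrite [RHS]addrACA !subrKA (scalerA s) mulrC -scalerA.
by rewrite subrKA.
Qed.

Lemma thetaD x c c' : theta x (c + c') = theta x c + theta x c'.
Proof. exact: linearD. Qed.

Lemma thetaB x c c' : theta x (c - c') = theta x c - theta x c'.
Proof. exact: linearB. Qed.

Lemma theta_lie_br x y c :
  theta (lie_br x y) c = theta y (theta x c) - theta x (theta y c).
Proof.
elim/chain_ind: c => [|c c' IH IH'|e|z c IH].
- by rewrite !linear0 addr0.
- rewrite !thetaD IH IH' /=.
  by rewrite opprD addrACA.
- rewrite !theta_chain0 -!twE tw_lie_br.
  apply/ffunP => A; rewrite !ffunE; case: ifP => // _.
  by rewrite subrr.
rewrite !theta_wedge !thetaB !theta_wedge IH lie_br_jacobi wedgeBl.
rewrite (linearB (wedge z)) /=.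
move: (wedge z _) (wedge z _) (wedge _ (theta x c)) (wedge _ (theta y c)) => p q r s.
rewrite !opprB [RHS]addrACA !subrKA [LHS]addrACA [RHS]addrACA.
by congr (_ + _); rewrite addrC.
Qed.

(** Both sides satisfy the same recursion in the exterior factor, by Cartan's
    formula and [theta_lie_br]. *)
Lemma koszul_theta x c : koszul f (theta x c) = theta x (koszul f c).
Proof.
elim/chain_ind: c => [|c c' IH IH'|e|y c IH].
- by rewrite !linear0.
- by rewrite !thetaD !(linearD (koszul f)) /= IH IH' !thetaD.
- by rewrite theta_chain0 !koszul_chain0 linear0.
rewrite theta_wedge (linearB (koszul f)) /= !koszul_wedge IH !thetaB.
rewrite theta_wedge theta_lie_br !opprB.
by rewrite addrC -addrA subrKA addrCA.
Qed.

(** * Acyclicity of the invertible part *)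

Hypothesis L_nil : lie_nilpotent L.

Lemma lower_central_sub m : (lower_central L m <= L)%VS.
Proof.
elim: m => //= m IH; apply/commv_subP => x y xL yL.
by apply: L_sub => //; apply: (subvP IH).
Qed.

Lemma iter_ad_lower j x y : vsval (iter j (lie_br x) y) \in lower_central L j.
Proof.
elim: j => [|j IH] /=; first exact: subvsP.
by rewrite vsval_lie_br; apply: (commv_subP _ _ _ (subvv _)) => //; apply: subvsP.
Qed.

Lemma ad_nilpotent : exists m, forall x y, iter m (lie_br x) y = 0.
Proof.
have [m Lm] := L_nil; exists m => x y; apply: val_inj.
have := iter_ad_lower m x y; rewrite Lm memv0 => /eqP h.
by rewrite [LHS]h [RHS](linear0 (@vsval _ _ L)).
Qed.

Lemma ad_ext_nilp x c : exists a, iter a (ad_ext x) c = 0.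
Proof.
have i0 a : iter a (ad_ext x) 0 = 0 by apply: iter_fix0; rewrite linear0.
elim/chain_ind: c => [|c c' [a ha] [b hb]|e|y c [a ha]].
- by exists 0.
- exists (b + a)%N; rewrite -[c']scale1r iter_linear scale1r iterD ha i0.
  by rewrite addnC iterD hb i0 addr0.
- by exists 1; rewrite /= ad_ext_chain0.
have [m hm] := ad_nilpotent; exists (a + m)%N.
apply: (leibniz_nilpotent (m := @wedge _ _ L) (D1 := lie_br x)
  (D2 := ad_ext x) (s := 1)) => //.
- exact: wedge0l.
- by move=> z; rewrite linear0.
- by move=> z d; rewrite scale1r /= ad_ext_wedge addrC.
Qed.

(** If [theta x c = 0], the two commuting operators [chain_act f x] and [ad_ext x]
    agree on [c], and so do their powers. Some power of the second kills [c],
    whereas the first is injective. *)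
Lemma theta_inj x V c : tw_stable V ->
  (forall v, v \in V -> tw x v = 0 -> v = 0) ->
  chain_in V c -> theta x c = 0 -> c = 0.
Proof.
move=> sV inj cV; rewrite thetaE => /subr0_eq AB.
have A_inj c' : chain_in V c' -> chain_act f x c' = 0 -> c' = 0.
  move=> c'V h; apply: chain_ext => A; rewrite ffunE; apply: inj => //.
  by rewrite -chain_actE h ffunE.
have [a] := ad_ext_nilp x c.
elim: a c cV AB => // a IH c cV AB; rewrite iterSr => hc.
apply: A_inj => //; rewrite AB; apply: IH => //; first exact: chain_in_ad_ext.
by rewrite chain_act_ad_ext AB.
Qed.

(** [theta x] is injective on the finite dimensional space of cycles with
    coefficients in [V], hence bijective, and Cartan's formula exhibits its
    values on cycles as boundaries. *)
Lemma acyclic x V p c : tw_stable V ->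
  (forall v, v \in V -> tw x v = 0 -> v = 0) ->
  c \in cycles f p -> chain_in V c -> c \in boundaries f p.
Proof.
move=> sV inj cZ cV.
pose Z := (cycles f p :&: chain_space V)%VS.
have ZP c' : c' \in Z -> [/\ c' \in chain_deg L p, koszul f c' = 0 & chain_in V c'].
  case/memv_capP => /memv_capP[dc]; rewrite memv_ker => /eqP kc hc.
  by split => //; apply/chain_spaceP.
have sub : (theta x @: Z <= Z)%VS.
  apply/subvP => _ /memv_imgP[c' /ZP[dc kc c'V] ->].
  rewrite memv_cap /cycles memv_cap memv_ker koszul_theta kc linear0 eqxx.
  rewrite theta_deg //=; apply/chain_spaceP.
  rewrite thetaE -scaleN1r; apply: chain_inD; first exact: chain_in_act.
  by apply: chain_inZ; apply: chain_in_ad_ext.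
have eqZ : (theta x @: Z = Z)%VS.
  apply/eqP; rewrite eqEdim sub /= limg_dim_eq //.
  apply/eqP; rewrite -subv0; apply/subvP => c' /memv_capP[/ZP[_ _ c'V]].
  by rewrite memv_ker memv0 => /eqP h; apply/eqP/(theta_inj sV inj).
have : c \in Z by rewrite memv_cap cZ; apply/chain_spaceP.
rewrite -eqZ => /memv_imgP[c' /ZP[dc kc _] ->].
apply/memv_imgP; exists (wedge x c'); first exact: wedge_deg.
by rewrite koszul_wedge kc linear0 subr0.
Qed.

Lemma tw_swap x y e : tw x (tw y e) = tw y (tw x e) - tw (lie_br x y) e.
Proof. by rewrite tw_lie_br opprB addrC subrK. Qed.

(** [tw y] moves the kernel of a power of [tw x] into the kernel of a higher
    power, the excess being bounded as [ad x] is nilpotent. *)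
Lemma lker_tw_stable x V a : tw_stable V ->
  (forall j, V :&: lker (lpow (tw x) (a + j)) <= V :&: lker (lpow (tw x) a))%VS ->
  tw_stable (V :&: lker (lpow (tw x) a))%VS.
Proof.
move=> sV ha y e /memv_capP[eV]; rewrite memv_ker lpowE => /eqP ek.
have [m hm] := ad_nilpotent.
apply: (subvP (ha m)); rewrite memv_cap sV // memv_ker lpowE.
rewrite (leibniz_nilpotent (m := fun y e => tw y e) (D1 := lie_br x)
  (D2 := tw x) (s := -1)) ?eqxx //.
- exact: tw0.
- by move=> z; rewrite linear0.
- by move=> z d; rewrite scaleN1r /= [LHS]tw_swap.
- exact: hm.
Qed.

(** Dually, [tw y] moves the image of a high power of [tw x] into the image of a
    lower one. *)
Lemma limg_tw_stable x V a : tw_stable V ->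
  (forall j, lpow (tw x) a @: V <= lpow (tw x) (a + j) @: V)%VS ->
  tw_stable (lpow (tw x) a @: V)%VS.
Proof.
move=> sV ha y e eI; have [m hm] := ad_nilpotent.
have /memv_imgP[v vV ->] := subvP (ha m) _ eI.
move: (hm x y); rewrite lpowE {ha eI e hm}.
elim: a m y v vV => [|a IHa] m y v vV.
  rewrite add0n => _; have -> : lpow (tw x) 0 = \1%VF by [].
  rewrite lim1g sV //; elim: m => //= m; exact: sV.
elim: m y => [|m IHm] y; first by move=> h; rewrite [y]h tw0 mem0v.
move=> hy; rewrite addnS iterS.
have -> u : tw y (tw x u) = tw x (tw y u) + tw (lie_br x y) u.
  by rewrite (tw_swap x y) subrK.
rewrite memvD //.
  rewrite addSnnS.
  have /memv_imgP[w wV ->] := IHa m.+1 y v vV hy.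
  apply/memv_imgP; exists w => //; by rewrite !lpowE.
by apply: IHm; rewrite -iterSr.
Qed.

(** * The nilpotent summand *)

Lemma cycle_split V1 V2 p c : tw_stable V1 -> tw_stable V2 ->
  (V1 :&: V2 = 0)%VS -> c \in cycles f p -> chain_in (V1 + V2)%VS c ->
  exists c1 c2, [/\ c = c1 + c2, c1 \in cycles f p, c2 \in cycles f p,
    chain_in V1 c1 & chain_in V2 c2].
Proof.
move=> s1 s2 V0 /memv_capP[dc]; rewrite memv_ker => /eqP kc cV.
pose c1 := chain_map (addv_pi1 V1 V2) c; pose c2 := chain_map (addv_pi2 V1 V2) c.
have cE : c = c1 + c2 by apply: chain_ext => A; rewrite !ffunE addv_pi1_pi2.
have in1 : chain_in V1 c1 by move=> A; rewrite ffunE memv_pi1.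
have in2 : chain_in V2 c2 by move=> A; rewrite ffunE memv_pi2.
have deg u : chain_map u c \in chain_deg L p.
  by apply/chain_degP => A Ap; rewrite ffunE (chain_degP _ _ dc) ?linear0.
have k12 : koszul f c1 = - koszul f c2.
  by apply/eqP; rewrite -addr_eq0 -linearD /= -cE kc.
have k1 : koszul f c1 = 0.
  apply: chain_ext => A; apply/eqP; rewrite [X in _ == X]ffunE -memv0 -V0.
  rewrite memv_cap chain_in_koszul //= k12 ffunE memvN; exact: chain_in_koszul.
have k2 : koszul f c2 = 0 by apply/eqP; rewrite -oppr_eq0 -k12 k1.
by exists c1, c2; split=> //; rewrite memv_cap deg memv_ker ?k1 ?k2 eqxx.
Qed.

(** That the sum is direct is expressed by the inequality of dimensions, the form
    in which it is inherited and used below. *)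
Definition complements V W :=
  [/\ tw_stable V, tw_stable W, (V + W = fullv)%VS &
      (\dim V + \dim W <= \dim {:E})%N].

(** Induction on the dimension of a summand [V] that supports a cycle which is no
    boundary: when some [tw x] is not nilpotent on [V], the Fitting component of
    the cycle in the image part is a boundary by [acyclic], so the component in
    the strictly smaller kernel part is not. *)
Lemma nilpotent_summand p c : c \in cycles f p -> c \notin boundaries f p ->
  exists V W, [/\ complements V W, V != 0%VS & forall x, nilp_on (tw x) V].
Proof.
suff H d V W c' : (\dim V <= d)%N -> complements V W -> c' \in cycles f p ->
    chain_in V c' -> c' \notin boundaries f p ->
    exists V W, [/\ complements V W, V != 0%VS & forall x, nilp_on (tw x) V].
  move=> cZ cB; apply: (H (\dim {:E}) fullv 0%VS c) => //; last by move=> A; exact: memvf.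
  split; rewrite ?addv0 ?dimv0 ?addn0 //; first by move=> x v _; exact: memvf.
  by move=> x v; rewrite !memv0 => /eqP ->; rewrite linear0.
elim: d V W c' => [|d IH] V W c' dV VW cZ cV cB.
all: have V0 : V != 0%VS.
all: try by apply: contraNneq cB => V0; rewrite (_ : c' = 0) ?mem0v //;
  apply: chain_ext => A; apply/eqP; rewrite [X in _ == X]ffunE -memv0 -V0.
  by move: dV; rewrite leqn0 dimv_eq0 (negPf V0).
have [|/existsNP[x xV]] := pselect (forall x, nilp_on (tw x) V).
  by exists V, W.
have [sV sW fVW dVW] := VW.
have [a [KI KI0 hK hI]] := fitting (sV x).
move: KI KI0; set K := (V :&: _)%VS; set I := (_ @: V)%VS => KI KI0.
have sK : tw_stable K by apply: lker_tw_stable.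
have sI : tw_stable I by apply: limg_tw_stable.
have dKI : (\dim K + \dim I = \dim V)%N by rewrite -KI dimv_disjoint_sum.
have I0 : (0 < \dim I)%N.
  rewrite lt0n dimv_eq0; apply: contra_notN xV => /eqP I0 v vV; exists a.
  by apply/eqP; rewrite -lpowE -memv0 -I0 memv_img.
have [|c1 [c2 [cE c1Z c2Z c1K c2I]]] := cycle_split sK sI KI0 cZ; first by rewrite KI.
have c2B : c2 \in boundaries f p.
  apply: (acyclic (x := x) sI) => // v vI xv0.
  apply/eqP; rewrite -memv0 -KI0 memv_cap vI andbT; apply: (subvP (hK 1)).
  rewrite addn1 memv_cap memv_ker lpowE iterSr xv0.
  rewrite iter_fix0 ?linear0 // eqxx andbT.
  by rewrite -KI (subvP (addvSr K I)).
apply: (IH K (I + W)%VS c1) => //.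
- by rewrite -ltnS (leq_trans _ dV) // -dKI -addn1 leq_add2l.
- split=> //; first 1 last.
  + by rewrite addvA KI.
  + apply: leq_trans dVW; rewrite -dKI -addnA leq_add2l.
    exact: (dimv_add_leqif I W).
  move=> y _ /memv_addP[u uI [w wW ->]].
  by rewrite linearD memv_add ?sI ?sW.
- by apply: contra cB => c1B; rewrite cE memvD.
Qed.

(** * Engel's theorem *)

Lemma tw_sum v I (r : seq I) (a : I -> F) (y : I -> g) :
  tw (\sum_(i <- r) a i *: y i) v = \sum_(i <- r) a i *: tw (y i) v.
Proof.
elim/big_rec2: _ => [|i u x _ <-]; first exact: tw0.
by rewrite !twE twact_linear_l.
Qed.

(** Modulo [W] the operator [tw y] commutes with the action of [L], so adding its
    image to [W] keeps stability. If this filled [V], iterating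
    [V = W + tw y V] would give [V = W + tw y ^ a V = W] for large [a]. *)
Lemma engel_step V W y : tw_stable V -> (W <= V)%VS -> (\dim W < \dim V)%N ->
  tw_stable W -> nilp_on (tw y) V ->
  (forall x v, v \in V -> tw (lie_br x y) v \in W) ->
  exists W', [/\ (W <= W')%VS, (W' <= V)%VS, (\dim W' < \dim V)%N, tw_stable W' &
    forall v, v \in V -> tw y v \in W'].
Proof.
move=> sV WV dW sW ny brW; exists (W + tw y @: V)%VS.
have W'V : (W + tw y @: V <= V)%VS.
  rewrite subv_add WV /=; apply/subvP => _ /memv_imgP[v vV ->]; exact: sV.
split=> //; first exact: addvSl; first last.
- by move=> v vV; rewrite (subvP (addvSr _ _)) // memv_img.
- move=> x _ /memv_addP[w wW [_ /memv_imgP[v vV ->] ->]].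
  rewrite linearD /= tw_swap addrCA memvD //.
    by rewrite (subvP (addvSr _ _)) // memv_img // sV.
  by rewrite (subvP (addvSl _ _)) //; apply: memvB; [apply: sW | apply: brW].
rewrite (ltn_leqif (dimv_leqif_sup W'V)); apply/negP => VW'.
have H a v : v \in V -> exists2 u, u \in V & v - iter a (tw y) u \in W.
  elim: a v => [|a IH] v vV; first by exists v => //; rewrite subrr mem0v.
  have /memv_addP[w wW [_ /memv_imgP[u uV ->] ->]] := subvP VW' _ vV.
  have [u' u'V hu] := IH _ uV; exists u' => //=.
  by rewrite -addrA -linearB memvD // sW.
move: dW; rewrite ltnNge => /negP; apply.
(* one exponent that works for the whole of V *)
have [a ha] : exists a, forall v, v \in V -> iter a (tw y) v = 0.
  have [a h] := lker_lpow_stable (tw y); exists a => v vV.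
  have [b hb] := ny v vV; apply/eqP; rewrite -lpowE -memv_ker.
  by apply: (subvP (h b)); rewrite memv_ker lpowE iterD hb iter_fix0 ?linear0.
by apply/dimvS/subvP => v vV; have [u uV] := H a v vV; rewrite ha // subr0.
Qed.

(** Descent along the lower central series: modulo a proper submodule that
    contains the images of [lower_central L m.+1], the elements of
    [lower_central L m] act centrally, and [engel_step] absorbs the images of a
    basis of it one at a time. *)
Lemma engel V : tw_stable V -> V != 0%VS -> (forall x, nilp_on (tw x) V) ->
  exists W, [/\ (W <= V)%VS, (\dim W < \dim V)%N &
    forall x v, v \in V -> tw x v \in W].
Proof.
move=> sV V0 nV.
pose P m := exists W, [/\ (W <= V)%VS, (\dim W < \dim V)%N, tw_stable W &
  forall x v, vsval x \in lower_central L m -> v \in V -> tw x v \in W].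
suff [W [WV dW _ h]] : P 0.
  by exists W; split=> // x v vV; apply: h => //; apply: subvsP.
have [m Lm] := L_nil.
have : P m.
  exists 0%VS; split; rewrite ?sub0v ?dimv0 ?lt0n ?dimv_eq0 //.
    by move=> x v; rewrite !memv0 => /eqP ->; rewrite linear0.
  move=> x v; rewrite Lm memv0 => /eqP x0 _.
  have -> : x = 0 by apply: val_inj; rewrite [LHS]x0 [RHS](linear0 (@vsval _ _ L)).
  by rewrite tw0 mem0v.
elim: m {Lm} => // m IH [W [WV dW sW hW]]; apply: IH.
have H (ys : seq g) : all (fun y => vsval y \in lower_central L m) ys ->
    exists W', [/\ (W' <= V)%VS, (\dim W' < \dim V)%N, tw_stable W', (W <= W')%VS &
      forall y v, y \in ys -> v \in V -> tw y v \in W'].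
  elim: ys => [|y ys IHy] /=; first by exists W; split.
  case/andP => ym /IHy[W1 [W1V dW1 sW1 WW1 h1]].
  have [|W2 [W12 W2V dW2 sW2 h2]] := engel_step (y := y) sV W1V dW1 sW1 (nV y).
    move=> x v vV; apply: (subvP WW1); apply: hW => //.
    by rewrite vsval_lie_br; apply: (commv_subP _ _ _ (subvv _)) => //; apply: subvsP.
  exists W2; split=> //; first exact: subv_trans W12.
  move=> z v; rewrite inE => /predU1P[->|zys]; first exact: h2.
  by move=> vV; apply: (subvP W12); apply: h1.
have bm (y : 'End(E)) : y \in vbasis (lower_central L m) -> vsval (vsproj L y) = y.
  by move=> /vbasis_mem ym; rewrite vsprojK // (subvP (lower_central_sub m)).
have [|W' [W'V dW' sW' WW' h]] := H (map (vsproj L) (vbasis (lower_central L m))).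
  by apply/allP => _ /mapP[y yb ->]; rewrite bm // vbasis_mem.
exists W'; split=> // x v xm vV.
have -> : x = \sum_(i < \dim (lower_central L m))
    coord (vbasis (lower_central L m)) i (vsval x)
      *: vsproj L (vbasis (lower_central L m))`_i.
  apply: val_inj; rewrite /= {1}(coord_vbasis xm).
  rewrite [RHS](linear_sum (@vsval _ _ L)); apply: eq_bigr => i _.
  by rewrite linearZ /= bm // mem_nth ?size_tuple.
rewrite tw_sum memv_suml // => i _; rewrite memvZ // h //.
by apply: map_f; rewrite mem_nth ?size_tuple.
Qed.

(** Iterating [engel] gives a strictly decreasing chain of submodules; its last
    nonzero term is annihilated by all [tw x]. *)
Lemma engel_kernel V : tw_stable V -> V != 0%VS -> (forall x, nilp_on (tw x) V) ->
  exists2 v, v != 0 & forall x, tw x v = 0.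
Proof.
move: {2}(\dim V) (leqnn (\dim V)) => d.
elim: d V => [|d IH] V dV sV V0 nV.
  by move: V0; rewrite -dimv_eq0 -leqn0 dV.
have [W [WV dW hW]] := engel sV V0 nV.
have [W0|W0] := eqVneq W 0%VS.
  exists (vpick V); first by rewrite vpick0.
  by move=> x; apply/eqP; rewrite -memv0 -W0 hW // memv_pick.
apply: (IH W) => //.
- by rewrite -ltnS (leq_trans dW).
- by move=> x v /(subvP WV); apply: hW.
- by move=> x v /(subvP WV); apply: nV.
Qed.

(** * Homology in the extreme degrees *)

Lemma homology0_neq0 (U : {vspace E}) : (forall x v, tw x v \in U) -> U != fullv ->
  exists h : homology f 0, h != 0.
Proof.
move=> hU Uf; apply/homology_neq0.
have [e _ eU] : exists2 e, e \in (fullv : {vspace E}) & e \notin U.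
  by apply/subvPn; apply: contra Uf => fU; rewrite eqEsubv subvf.
exists (chain0 L e).
  rewrite memv_cap memv_ker koszul_chain0 eqxx andbT.
  exact: (tens_deg e [::]).
apply: contra eU => /memv_imgP[c /chain_degP c1 /ffunP/(_ set0)].
rewrite ffunE eqxx => ->.
rewrite [c]chain_sum linear_sum sum_ffunE memv_suml // => A _.
have [/cards1P[i ->]|/c1 ->] := boolP (#|A| == 1); last first.
  rewrite (_ : tens 0 _ = 0) ?linear0 ?ffunE ?mem0v //.
  by apply: chain_ext => B; rewrite tens_monomial ffunE if_same.
rewrite enum_set1 /= koszul_wedge koszul_chain0 linear0 subr0 theta_chain0 -twE.
by rewrite ffunE eqxx.
Qed.

(** The top chain with coefficient [v] is an eigenvector of every [ad_ext x], with
    eigenvalue zero by nilpotency, so it is killed by every [theta x]. By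
    Cartan's formula its differential is then killed by all exterior
    multiplications, which forces a chain of degree [n.-1] to vanish. *)
Lemma homologyn_neq0 v : v != 0 -> (forall x, tw x v = 0) ->
  exists h : homology f n, h != 0.
Proof.
move=> v0 hv; apply/homology_neq0.
pose s := map (@lbasis _ _ L) (enum [set: 'I_n]).
have ss : size s = n by rewrite size_map -cardE cardsT card_ord.
pose c := tens v s.
have cA A : c A = if A == setT then v else 0 by exact: tens_monomial.
have cn : c \in chain_deg L n by have := tens_deg v s; rewrite ss.
have top0 (d : chain L) : d \in chain_deg L n -> d setT = 0 -> d = 0.
  move=> /chain_degP hd dT; apply: chain_ext => A; rewrite ffunE.
  have [->//|AT] := eqVneq A setT; apply: hd.
  by apply: contra AT => An; rewrite eqEcard subsetT cardsT card_ord (eqP An) leqnn.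
have c0 : c != 0.
  by apply: contra v0 => /eqP/ffunP/(_ setT); rewrite cA eqxx ffunE => ->.
have over (d : chain L) : d \in chain_deg L n.+1 -> d = 0.
  move=> /chain_degP hd; apply: chain_ext => A; rewrite ffunE hd // neq_ltn ltnS.
  by rewrite -[X in (_ <= X)%N]card_ord max_card.
have adc x : ad_ext x c = 0.
  have /vlineP[t ht] : ad_ext x c setT \in <[v]>%VS.
    apply: chain_in_ad_ext => A; rewrite cA; case: ifP; rewrite ?mem0v ?memv_line //.
  have e : ad_ext x c = t *: c.
    apply: subr0_eq; apply: top0; first by rewrite rpredB ?memvZ ?ad_ext_deg.
    by rewrite !ffunE ht cA eqxx subrr.
  have [a ha] := ad_ext_nilp x c.
  have it b : iter b (ad_ext x) c = t ^+ b *: c.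
    elim: b => [|b IH]; first by rewrite scale1r.
    by rewrite /= IH linearZ /= e scalerA exprSr.
  move/eqP: ha; rewrite it scaler_eq0 (negPf c0) orbF expf_eq0 => /andP[_ /eqP t0].
  by rewrite e t0 scale0r.
have thc x : theta x c = 0.
  rewrite thetaE adc subr0; apply: chain_ext => A.
  by rewrite chain_actE cA ffunE; case: ifP; rewrite ?linear0 ?hv.
(* wedge x c has degree n.+1 *)
have wk x : wedge x (koszul f c) = 0.
  have := koszul_wedge x c; rewrite (over (wedge x c)) ?wedge_deg //.
  by rewrite thc linear0 sub0r => /eqP; rewrite eq_sym oppr_eq0 => /eqP.
have kc : koszul f c = 0.
  have kd := koszul_tens_deg v s.
  apply: chain_ext => A; rewrite [RHS]ffunE.
  have [AT|] := eqVneq A setT.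
    have [s0|n0] := posnP n.
      have -> : c = chain0 L v by rewrite /c (size0nil (etrans ss s0)).
      by rewrite koszul_chain0 ffunE.
    rewrite (chain_degP _ _ kd) // AT ss cardsT card_ord.
    by rewrite -(prednK n0) neq_ltn ltnSn orbT.
  rewrite -subTset => /subsetPn[i _ iA].
  have /ffunP/(_ (i |: A)) := wk (lbasis i).
  rewrite wedge_lbasis !ffunE setU11 setU1K // => /eqP.
  by rewrite scaler_eq0 signr_eq0 => /eqP.
exists c; first by rewrite memv_cap cn memv_ker kc eqxx.
by apply: contra c0 => /memv_imgP[d /over -> ->]; rewrite linear0.
Qed.

Lemma homology_extremes p : (exists h : homology f p, h != 0) ->
  (exists h : homology f 0, h != 0) /\ (exists h : homology f n, h != 0).
Proof.
move=> /homology_neq0[c cZ cB].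
have [V [W [[sV sW VW dVW] V0 nV]]] := nilpotent_summand cZ cB.
split; last by have [v v0 hv] := engel_kernel sV V0 nV; exact: homologyn_neq0 hv.
have [V' [V'V dV' hV']] := engel sV V0 nV.
apply: (homology0_neq0 (U := (V' + W)%VS)).
  move=> x e; have /memv_addP[v vV [w wW ->]] : e \in (V + W)%VS by rewrite VW memvf.
  by rewrite linearD memv_add ?hV' ?sW.
apply: contraTneq dVW => UE; rewrite -ltnNge -UE.
by apply: leq_ltn_trans (dimv_add_leqif V' W) _; rewrite ltn_add2r.
Qed.

End Twisted.
End Koszul.

(** * The joint spectrum *)

Theorem theorem3p5 (R : realType) (E : vectType R[i]) (L : {vspace 'End(E)})
    (L_sub : lie_subalgebra L) (L_nil : lie_nilpotent L)
    (k : nat) (k_le_n : (k <= \dim L)%N) :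
  joint_spectrum L = sigma_delta L k /\ sigma_delta L k = sigma_pi L k.
Proof.
have ext f : joint_spectrum L f -> Sigma_ L 0 f /\ Sigma_ L (\dim L) f.
  move=> [f_char [p /(homology_extremes L_sub f_char L_nil)[h0 hn]]].
  by split; split.
have deltaE : sigma_delta L k = joint_spectrum L.
  apply/predeqP => f; split=> [[p _ [fc hp]] | /ext[h0 _]].
    by split=> //; exists p.
  by exists 0.
have piE : sigma_pi L k = joint_spectrum L.
  apply/predeqP => f; split=> [[p _ [fc hp]] | /ext[_ hn]].
    by split=> //; exists p.
  by exists (\dim L); rewrite //= k_le_n leqnn.
by rewrite deltaE piE.
Qed.
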